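(* Let $M_d,M_a,W$ be finite-dimensional vector spaces, let $f:M_d\times M_a\to M_d$ and $\phi:M_d\times M_a\to W$ define an index 1 DAE $\dot q=f(q,u)$, $0=\phi(q,u)$, let $L:M_d\times M_a\to\mathbb R$ be a function, and let $a_{ij}$, $b_i>0$ ($1\le i,j\le s$) be Runge--Kutta coefficients with $\tilde a_{ij}=(b_ib_j-b_ja_{ji})/b_i$. Suppose $q_0,q_1,Q^i\in M_d$, $U^i\in M_a$, $p_0,p_1,P^i\in M_d^*$, $\Lambda^i\in W^*$ satisfy $$q_1=q_0+\Delta t\sum_ib_if(Q^i,U^i),\qquad Q^i=q_0+\Delta t\sum_ja_{ij}f(Q^j,U^j),$$ $$p_1=p_0-\Delta t\sum_ib_i\big([D_qf(Q^i,U^i)]^*P^i+[D_q\phi(Q^i,U^i)]^*\Lambda^i+D_qL(Q^i,U^i)\big),$$ $$P^i=p_0-\Delta t\sum_j\tilde a_{ij}\big([D_qf(Q^j,U^j)]^*P^j+[D_q\phi(Q^j,U^j)]^*\Lambda^j+D_qL(Q^j,U^j)\big),$$ $$0=\phi(Q^i,U^i),\qquad 0=[D_uf(Q^i,U^i)]^*P^i+[D_u\phi(Q^i,U^i)]^*\Lambda^i+D_uL(Q^i,U^i),$$ and suppose $\delta q_0,\delta q_1,\delta Q^i\in M_d$, $\delta U^i\in M_a$ satisfy the discrete variational equations $$\delta q_1=\delta q_0+\Delta t\sum_ib_i\big(D_qf(Q^i,U^i)\delta Q^i+D_uf(Q^i,U^i)\delta U^i\big),$$ $$\delta Q^i=\delta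 q_0+\Delta t\sum_ja_{ij}\big(D_qf(Q^j,U^j)\delta Q^j+D_uf(Q^j,U^j)\delta U^j\big),$$ $$0=D_q\phi(Q^i,U^i)\delta Q^i+D_u\phi(Q^i,U^i)\delta U^i.$$ Then $$\langle p_1,\delta q_1\rangle=\langle p_0,\delta q_0\rangle-\Delta t\sum_ib_i\langle dL(Q^i,U^i),(\delta Q^i,\delta U^i)\rangle.$$
   Context: All maps are smooth; $\Delta t>0$ is the timestep; $\langle\cdot,\cdot\rangle$ is the duality pairing and $[\cdot]^*$ the dual linear map. Index 1 means $D_u\phi(q,u):M_a\to W$ is invertible at every point where $\phi(q,u)=0$. The first system is the presymplectic Galerkin Hamiltonian variational integrator applied to the augmented adjoint DAE system with Hamiltonian $H_L(q,u,p,\lambda)=\langle p,f(q,u)\rangle+\langle\lambda,\phi(q,u)\rangle+L(q,u)$. Here $\langle dL(q,u),(\delta q,\delta u)\rangle=\langle D_qL,\delta q\rangle+\langle D_uL,\delta u\rangle$. *)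

(* Defs.v *)
From HB Require Import structures.
From mathcomp Require Import all_boot all_order all_algebra.
From mathcomp Require Import classical_sets reals topology normedtype derive.
Set Implicit Arguments.
Unset Strict Implicit.
Unset Printing Implicit Defensive.
Import Order.TTheory GRing.Theory Num.Theory.
Import numFieldNormedType.Exports.
Local Open Scope ring_scope.

(* Finite-dimensional vector spaces carrying a norm.  All norms on such a space
   are equivalent, so which maps are differentiable or smooth, and what their
   differentials are, does not depend on the norm carried. *)
#[short(type="finNormedModType")]
HB.structure Definition FinNormedModule (R : numFieldType) :=
  {V of NormedModule R V & Vector R V}.

HB.instance Definition _ (R : realType) := Vector.on R^o.
HB.instance Definition _ (R : realType) (V1 V2 : finNormedModType R) :=
  Vector.on (V1 * V2)%type.

(* The derivative x |-> 'd f x is asked to be C^k after evaluation at each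
   vector v; since V is finite-dimensional, this is the same as being C^k into
   the space of linear maps. *)
Fixpoint Ck (R : realType) (V W : finNormedModType R) (k : nat)
    (f : V -> W) : Prop :=
  if k is k'.+1 then
    (forall x, differentiable f x) /\ (forall v, Ck k' (fun x => 'd f x v))
  else continuous f.

Definition smooth (R : realType) (V W : finNormedModType R) (f : V -> W) :=
  forall k, Ck k f.

Section PartialDerivatives.
Context (R : realType) (V1 V2 W : finNormedModType R).
Implicit Type f : V1 * V2 -> W.

Definition Dq f (q : V1) (u : V2) : 'Hom(V1, W) :=
  linfun ('d (fun q' => f (q', u)) q).

Definition Du f (q : V1) (u : V2) : 'Hom(V2, W) :=
  linfun ('d (fun u' => f (q, u')) u).

Definition index1 f :=
  forall q u, f (q, u) = 0 -> bijective (Du f q u).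

End PartialDerivatives.

(* The dual space of V is 'Hom(V, R^o), the duality pairing is application. *)
Definition dual_map (R : realType) (V W : vectType R) (A : 'Hom(V, W))
    (p : 'Hom(W, R^o)) : 'Hom(V, R^o) := (p \o A)%VF.

Definition tilde (R : realType) (s : nat) (a : 'M[R]_s) (b : 'I_s -> R)
    (i j : 'I_s) : R :=
  (b i * b j - b j * a j i) / b i.

(* Main.v *)
Require Import Defs.
From mathcomp Require Import all_boot all_order all_algebra.
From mathcomp Require Import reals topology normedtype derive.
From mathcomp Require Import ring.
Import GRing.Theory Num.Theory.
Local Open Scope ring_scope.

(* Expanding [p1 dq1] produces the double sum of [b i * b j * G i (F j)]; replacing
   [p0] by [P i] and [dq0] by [dQ i] in the terms linear in [dt] creates the double
   sums with weights [b i * tilde a b i j] and [b i * a i j], and these cancel it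
   since [b i * tilde a b i j + b j * a j i = b i * b j]. *)
Lemma symplectic_RK_pairing {R : realType} {V : vectType R} {dt : R} {s : nat}
  {a : 'M[R]_s} {b : 'I_s -> R} {p0 p1 : 'Hom(V, R^o)}
  {P G : 'I_s -> 'Hom(V, R^o)} {x0 x1 : V} {X F : 'I_s -> V} :
  (forall i, b i != 0) ->
  p1 = p0 - dt *: \sum_i b i *: G i ->
  (forall i, P i = p0 - dt *: \sum_j tilde a b i j *: G j) ->
  x1 = x0 + dt *: \sum_i b i *: F i ->
  (forall i, X i = x0 + dt *: \sum_j a i j *: F j) ->
  p1 x1 = p0 x0 + dt * \sum_i b i * (P i (F i) - G i (X i)).
Proof.
move=> b_neq0 p1E PE x1E XE.
(* The weights [c] stay free: [b] serves the end values, the rows of [tilde a b] and of [a] serve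
   the stages. *)
have comb (c : 'I_s -> R) x :
    (p0 - dt *: \sum_i c i *: G i) x = p0 x - dt * \sum_i c i * G i x.
  rewrite add_lfunE opp_lfunE scale_lfunE sum_lfunE.
  by congr (_ - dt * _); apply: eq_bigr => i _; rewrite scale_lfunE.
have lin (g : 'Hom(V, R^o)) (c : 'I_s -> R) :
    g (x0 + dt *: \sum_i c i *: F i) = g x0 + dt * \sum_i c i * g (F i).
  rewrite linearD linearZ linear_sum.
  by congr (_ + dt * _); apply: eq_bigr => i _; rewrite linearZ.
have summandE i : b i * (P i (F i) - G i (X i)) =
    b i * p0 (F i) - b i * G i x0 -
    dt * \sum_j (b i * tilde a b i j * G j (F i) + b i * a i j * G i (F j)).
  rewrite PE XE comb lin big_split /=.
  under [X in dt * (X + _)]eq_bigr do rewrite -mulrA.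
  under [X in dt * (_ + X)]eq_bigr do rewrite -mulrA.
  rewrite -!mulr_sumr; ring.
have crossE : \sum_i \sum_j (b i * tilde a b i j * G j (F i) +
    b i * a i j * G i (F j)) = \sum_i \sum_j b i * (b j * G i (F j)).
  under eq_bigr do rewrite big_split /=.
  (* Swapping the indices of the first double sum makes both terms multiples of [G i (F j)], with
     total weight [b j * tilde a b j i + b i * a i j]. *)
  rewrite big_split /= exchange_big -big_split /=.
  apply: eq_bigr => i _; rewrite -big_split /=; apply: eq_bigr => j _.
  by rewrite /tilde; field.
under [in RHS]eq_bigr do rewrite summandE.
(* Both sides now contain the same double sum, with factor [- dt * dt]; on the left it comes from
   expanding [G i x1]. *)
rewrite !sumrB -mulr_sumr crossE p1E x1E comb !lin.
under [X in _ - dt * X]eq_bigr do rewrite lin mulrDr mulrCA mulr_sumr.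
rewrite big_split /= -mulr_sumr.
ring.
Qed.

(** Chain rule along the two slices through [(q, u)], whose differentials are the injections
    [x |-> (x, 0)] and [x |-> (0, x)], then linearity. *)
Lemma diff_partials {R : realType} {V1 V2 W : finNormedModType R}
  {g : V1 * V2 -> W} {q : V1} {u : V2} (dq : V1) (du : V2) :
  differentiable g (q, u) ->
  'd g (q, u) (dq, du) = Dq g q u dq + Du g q u du.
Proof.
move=> dg; rewrite /Dq /Du !lfunE /=.
have d1 : differentiable (fun q' : V1 => (q', u)) q by [].
have d2 : differentiable (fun u' : V2 => (q, u')) u by [].
rewrite (@diff_comp _ _ _ _ (fun q' : V1 => (q', u)) g q d1 dg).
rewrite (@diff_comp _ _ _ _ (fun u' : V2 => (q, u')) g u d2 dg).
have e1 : 'd (fun q' : V1 => (q', u)) q = (fun x => (x, 0)) :> (V1 -> V1 * V2).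
  exact: diff_val.
have e2 : 'd (fun u' : V2 => (q, u')) u = (fun x => (0, x)) :> (V2 -> V1 * V2).
  exact: diff_val.
rewrite [X in _ = X + _]/= [X in _ = _ + X]/= e1 e2 -linearD.
by have -> : (dq, du) = (dq, 0) + (0, du) by congr (_, _); rewrite (addr0, add0r).
Qed.

Theorem proposition3p3 (R : realType) (Md Ma W : finNormedModType R)
  (f : Md * Ma -> Md) (phi : Md * Ma -> W) (L : Md * Ma -> R^o)
  (f_smooth : smooth f) (phi_smooth : smooth phi) (L_smooth : smooth L)
  (phi_index1 : index1 phi)
  (dt : R) (dt_gt0 : 0 < dt)
  (s : nat) (a : 'M[R]_s) (b : 'I_s -> R) (b_gt0 : forall i, 0 < b i)
  (q0 q1 : Md) (Q : 'I_s -> Md) (U : 'I_s -> Ma)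
  (p0 p1 : 'Hom(Md, R^o)) (P : 'I_s -> 'Hom(Md, R^o))
  (Lam : 'I_s -> 'Hom(W, R^o))
  (q1E : q1 = q0 + dt *: \sum_i b i *: f (Q i, U i))
  (QE : forall i, Q i = q0 + dt *: \sum_j a i j *: f (Q j, U j))
  (p1E : p1 = p0 - dt *: \sum_i b i *:
     (dual_map (Dq f (Q i) (U i)) (P i) + dual_map (Dq phi (Q i) (U i)) (Lam i)
        + Dq L (Q i) (U i)))
  (PE : forall i, P i = p0 - dt *: \sum_j tilde a b i j *:
     (dual_map (Dq f (Q j) (U j)) (P j) + dual_map (Dq phi (Q j) (U j)) (Lam j)
        + Dq L (Q j) (U j)))
  (phiE : forall i, 0 = phi (Q i, U i))
  (LamE : forall i,
     0 = dual_map (Du f (Q i) (U i)) (P i) + dual_map (Du phi (Q i) (U i)) (Lam i)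
        + Du L (Q i) (U i))
  (dq0 dq1 : Md) (dQ : 'I_s -> Md) (dU : 'I_s -> Ma)
  (dq1E : dq1 = dq0 + dt *: \sum_i b i *:
     (Dq f (Q i) (U i) (dQ i) + Du f (Q i) (U i) (dU i)))
  (dQE : forall i, dQ i = dq0 + dt *: \sum_j a i j *:
     (Dq f (Q j) (U j) (dQ j) + Du f (Q j) (U j) (dU j)))
  (dphiE : forall i,
     0 = Dq phi (Q i) (U i) (dQ i) + Du phi (Q i) (U i) (dU i)) :
  p1 dq1 = p0 dq0 - dt * \sum_i b i * 'd L (Q i, U i) (dQ i, dU i).
Proof.
have b_neq0 i : b i != 0 by apply: lt0r_neq0.
(* Here [G i] is the bracket of the adjoint equation and [F i] the linearised vector field at stage
   [i]. What remains is an identity at each single stage, free of [dt], [a] and [b]. *)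
rewrite (symplectic_RK_pairing b_neq0 p1E PE dq1E dQE).
rewrite -mulrN -sumrN; congr (_ + dt * _); apply: eq_bigr => i _.
rewrite -mulrN; congr (_ * _).
rewrite diff_partials; last by case: (L_smooth 1%N).
(* The [Dq f] terms cancel by duality. The linearised constraint paired with [Lam i] trades [Dq phi]
   for [Du phi], and the [u]-stationarity condition at [dU i] turns the remaining [u]-terms into
   [Du L]. *)
have := congr1 (fun h : 'Hom(Ma, R^o) => h (dU i)) (LamE i).
have := congr1 (Lam i) (dphiE i).
rewrite linear0 !linearD !add_lfunE !comp_lfunE zero_lfunE /=.
move=> /esym/eqP; rewrite addr_eq0 => /eqP ->.
move=> /esym/eqP; rewrite addr_eq0 => /eqP.
move/(congr1 -%R); rewrite opprK => <-.
ring.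
Qed.
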